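(* Let $\mathrm{AP}$ be a finite set of atomic propositions. For every LTL formula $\varphi$ over $\mathrm{AP}$ (built from the connectives $\neg$, $\vee$, ${\mathcal U}$, ${\mathcal S}$, ${\mathcal U}'$, ${\mathcal S}'$), there is an automaton $\mathcal A_\varphi$ with input alphabet $2^{\mathrm{AP}}$ and output alphabet $\{0,1\}$ which, given any input word $x$ (indexed by an arbitrary linear ordering), outputs the truth word $v_\varphi(x)$; that is, for every word $x$ over $2^{\mathrm{AP}}$, $\mathcal A_\varphi$ has an accepting run on $x$, and every accepting run of $\mathcal A_\varphi$ on $x$ has output $v_\varphi(x)$.
   Context: Linear orderings and cuts. A linear ordering is a totally ordered set $(J,<)$. A cut of $J$ is a partition $(K,L)$ of $J$ (with $K$ or $L$ possibly empty) such that $k<l$ for all $k\in K$, $l\in L$. The set $\hat J$ of cuts is ordered by $(K_1,L_1)<(K_2,L_2)$ iff $K_1\subsetneq K_2$; this order extends to $J\cup\hat J$ by $(K,L)<j$ iff $j\in L$ (and $j<(K,L)$ iff $j\in K$). Its least and greatest elements are $c_{\min}=(\emptyset,J)$ and $c_{\max}=(J,\emptyset)$. For $j\in J$, $c_j^-=(\{i<j\},\{i\ge j\})$ and $c_j^+=(\{i\le j\},\{i>j\})$. A gap is a cut $c\notin\{c_{\min},c_{\max}\}$ that has neither a successor nor a predecessor in $\hat J$. A word of length $J$ over an alphabet $\Sigma$ is a family $(x_j)_{j\in J}$ with $x_j\in\Sigma$; $-x$ denotes the same family indexed by $J$ with the reversed order. LTL semantics. Formulas: $\varphi ::= p \mid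 \neg\varphi\mid \varphi\vee\varphi\mid \varphi\,{\mathcal U}\,\varphi\mid\varphi\,{\mathcal S}\,\varphi\mid \varphi\,{\mathcal U}'\,\varphi\mid\varphi\,{\mathcal S}'\,\varphi$ with $p\in\mathrm{AP}$. They are evaluated at a position $i$ of a word $x=(x_j)_{j\in J}$ over $2^{\mathrm{AP}}$: $x,i\models p$ iff $p\in x_i$; negation and disjunction as usual; $x,i\models\psi_1{\mathcal U}\psi_2$ iff there is $j>i$ with $x,j\models\psi_2$ and $x,k\models\psi_1$ for all $k$ with $i<k<j$ (strict until); $x,i\models\psi_1{\mathcal S}\psi_2$ iff $-x,i\models\psi_1{\mathcal U}\psi_2$; $x,i\models\psi_1{\mathcal U}'\psi_2$ iff there is a gap $c\in\hat J$ with $c>i$ such that (1) $x,j\models\psi_1$ for every position $j$ with $i<j<c$, (2) for every position $k>c$ there is a position $j$ with $c<j<k$ and $x,j\not\models\psi_1$, and (3) there is a position $k>c$ such that $x,j\models\psi_2$ for every position $j$ with $c<j<k$; $x,i\models\psi_1{\mathcal S}'\psi_2$ iff $-x,i\models\psi_1{\mathcal U}'\psi_2$. The truth word $v_\varphi(x)$ is the word of length $J$ over $\{0,1\}$ with letter $1$ at position $j$ iff $x,j\models\varphi$. Automata. An automaton is $\mathcal A=(Q,\Sigma,\Gamma,\delta,I,F)$ with $Q$ a finite set of states, $\Sigma$ an input alphabet, $\Gamma$ an output alphabet, $I,F\subseteq Q$ initial and final states, and $\delta\subseteq (Q\times\Sigma\times\Gamma\times Q)\cup(2^Q\times Q)\cup(Q\times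 2^Q)$: successor transitions $p\xrightarrow{a|b}q$, left limit transitions $P\to q$, right limit transitions $q\to P$. For a word $\rho=(\rho_c)_{c\in\hat J}$ over $Q$ and $c\in\hat J$, let $\lim_{c^-}\rho=\{q\mid \forall d<c\ \exists e\ (d<e<c\wedge \rho_e=q)\}$ and $\lim_{c^+}\rho=\{q\mid\forall d>c\ \exists e\ (c<e<d\wedge\rho_e=q)\}$. An accepting run of $\mathcal A$ on a word $x=(x_j)_{j\in J}$ over $\Sigma$ is a word $\rho$ of length $\hat J$ over $Q$ together with output letters $(y_j)_{j\in J}$ in $\Gamma$ such that: $\rho_{c_{\min}}\in I$ and $\rho_{c_{\max}}\in F$; for each $j\in J$, $(\rho_{c_j^-},x_j,y_j,\rho_{c_j^+})\in\delta$; for each $c\ne c_{\min}$ with no predecessor in $\hat J$, $(\lim_{c^-}\rho,\rho_c)\in\delta$; and for each $c\neq c_{\max}$ with no successor in $\hat J$, $(\rho_c,\lim_{c^+}\rho)\in\delta$. The output of the run is the word $(y_j)_{j\in J}$. *)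

(* Defs.v *)
From mathcomp Require Import all_boot all_order.
From mathcomp Require Import boolp classical_sets.

Set Implicit Arguments.
Unset Strict Implicit.
Unset Printing Implicit Defensive.

Import Order.TTheory.
Local Open Scope order_scope.
Local Open Scope classical_set_scope.

(* A word of length J over an alphabet S is a plain function J -> S. *)

Section Cuts.
Context {d : Order.disp_t} {J : orderType d}.

(* The cut (K, L) is given by below := K and above := L.  The order between
   positions and cuts reads: j < c iff below c j, and c < j iff above c j. *)
Record cut := Cut {
  below : set J;
  above : set J;
  cut_cover : below `|` above = setT;
  cut_disjoint : below `&` above = set0;
  cut_sorted : forall k l, below k -> above l -> k < l }.

Definition cut_lt (c1 c2 : cut) : Prop := below c1 `<` below c2.

Definition cut_succ (c1 c2 : cut) : Prop :=
  cut_lt c1 c2 /\ ~ exists e, cut_lt c1 e /\ cut_lt e c2.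

Definition has_pred (c : cut) : Prop := exists c', cut_succ c' c.
Definition has_succ (c : cut) : Prop := exists c', cut_succ c c'.

Definition cmin : cut :=
  @Cut set0 setT (set0U _) (set0I _) (fun k l k0 _ => False_ind _ k0).

Definition cmax : cut :=
  @Cut setT set0 (setU0 _) (setI0 _) (fun k l _ l0 => False_ind _ l0).

Fact cut_before_cover (j : J) : [set i | i < j] `|` [set i | j <= i] = setT.
Proof. by apply/seteqP; split=> i //= _; case: (ltP i j); [left|right]. Qed.

Fact cut_before_disjoint (j : J) : [set i | i < j] `&` [set i | j <= i] = set0.
Proof. by apply/seteqP; split=> i //= []; case: (ltP i j). Qed.

Definition cut_before (j : J) : cut :=
  Cut (cut_before_cover j) (cut_before_disjoint j)
      (fun k l => @lt_le_trans _ _ j k l).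

Fact cut_after_cover (j : J) : [set i | i <= j] `|` [set i | j < i] = setT.
Proof. by apply/seteqP; split=> i //= _; case: (leP i j); [left|right]. Qed.

Fact cut_after_disjoint (j : J) : [set i | i <= j] `&` [set i | j < i] = set0.
Proof. by apply/seteqP; split=> i //= []; case: (leP i j). Qed.

Definition cut_after (j : J) : cut :=
  Cut (cut_after_cover j) (cut_after_disjoint j)
      (fun k l => @le_lt_trans _ _ j k l).

Definition gap (c : cut) : Prop :=
  [/\ c <> cmin, c <> cmax, ~ has_succ c & ~ has_pred c].

End Cuts.
Arguments cut {d} J.

Inductive ltl (AP : Type) : Type :=
| Atom of AP
| Neg of ltl AP
| Or of ltl AP & ltl AP
| Until of ltl AP & ltl AP
| Since of ltl AP & ltl AP
| StaviUntil of ltl AP & ltl AP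
| StaviSince of ltl AP & ltl AP.

Section Connectives.
Context {d : Order.disp_t} {J : orderType d}.

Definition until (P1 P2 : set J) : set J :=
  [set i | exists j, [/\ i < j, P2 j & forall k, i < k -> k < j -> P1 k]].

Definition stavi_until (P1 P2 : set J) : set J :=
  [set i | exists c : cut J,
    [/\ gap c /\ below c i,
        forall j, i < j -> below c j -> P1 j,
        forall k, above c k -> exists j, [/\ above c j, j < k & ~ P1 j]
      & exists k, above c k /\ forall j, above c j -> j < k -> P2 j]].

End Connectives.

(* The past connectives are the future ones over the reversed ordering J^d.
   Only the outermost connective is mirrored: P1 and P2 stay the sets of
   positions at which the operands hold in the original word. *)
Definition since d (J : orderType d) (P1 P2 : set J) : set J :=
  @until _ J^d P1 P2.
Definition stavi_since d (J : orderType d) (P1 P2 : set J) : set J :=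
  @stavi_until _ J^d P1 P2.

Fixpoint sat (AP : finType) d (J : orderType d) (x : J -> {set AP})
    (phi : ltl AP) : set J :=
  match phi with
  | Atom p => [set i | p \in x i]
  | Neg psi => [set i | ~ sat x psi i]
  | Or psi1 psi2 => [set i | sat x psi1 i \/ sat x psi2 i]
  | Until psi1 psi2 => until (sat x psi1) (sat x psi2)
  | Since psi1 psi2 => since (sat x psi1) (sat x psi2)
  | StaviUntil psi1 psi2 => stavi_until (sat x psi1) (sat x psi2)
  | StaviSince psi1 psi2 => stavi_since (sat x psi1) (sat x psi2)
  end.

Definition truth_word (AP : finType) d (J : orderType d) (x : J -> {set AP})
    (phi : ltl AP) : J -> bool :=
  fun j => `[< sat x phi j >].

(* The transition relation is split into its three disjoint components. *)
Record automaton (Sigma Gamma : finType) := Automaton {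
  state : finType;
  succ_trans : {set state * Sigma * Gamma * state};
  left_lim_trans : {set {set state} * state};
  right_lim_trans : {set state * {set state}};
  init : {set state};
  final : {set state} }.

Section Runs.
Context {d : Order.disp_t} {J : orderType d}.

Definition lim_left (Q : finType) (rho : cut J -> Q) (c : cut J) : {set Q} :=
  finset (fun q => `[< forall c', cut_lt c' c ->
    exists e, [/\ cut_lt c' e, cut_lt e c & rho e = q] >]).

Definition lim_right (Q : finType) (rho : cut J -> Q) (c : cut J) : {set Q} :=
  finset (fun q => `[< forall c', cut_lt c c' ->
    exists e, [/\ cut_lt c e, cut_lt e c' & rho e = q] >]).

Definition accepting_run (Sigma Gamma : finType) (A : automaton Sigma Gamma)
    (x : J -> Sigma) (rho : cut J -> state A) (y : J -> Gamma) : Prop :=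
  [/\ rho cmin \in init A /\ rho cmax \in final A,
      forall j, (rho (cut_before j), x j, y j, rho (cut_after j))
                  \in succ_trans A,
      forall c, c <> cmin -> ~ has_pred c ->
        (lim_left rho c, rho c) \in left_lim_trans A
    & forall c, c <> cmax -> ~ has_succ c ->
        (rho c, lim_right rho c) \in right_lim_trans A].

End Runs.

(* Main.v *)
Require Import Defs.
From mathcomp Require Import all_boot all_order.
From mathcomp Require Import boolp classical_sets.

(* Truth functions of formulas are closed under pairing and cascading of automata
   and under reversing the order, so each connective needs one automaton.  For U
   and U', call a cut a target if it is c_j^- with P2 true at j, respectively a gap
   as in the definition of U'; then i satisfies the formula iff the cut c_i^+
   reaches a target cut with P1 true at all positions in between.  An automaton
   guesses at every cut whether it reaches a target, and remembers the letter just
   before the cut, so that its limit sets tell whether P1 or P2 fails arbitrarily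
   close to a limit cut.  The guesses are forced to be right by induction along the
   Dedekind-complete order of cuts, upwards from a wrong positive guess (which would
   propagate to c_max) and downwards from a reached target. *)

Set Implicit Arguments.
Unset Strict Implicit.
Unset Printing Implicit Defensive.

Import Order.TTheory.
Local Open Scope order_scope.
Local Open Scope classical_set_scope.

(** * The complete linear order of cuts and induction along it *)

Section CutOrder.
Context {d : Order.disp_t} {J : orderType d}.
Implicit Types (c e : cut J) (i j k : J).

Definition cut_le c1 c2 : Prop := below c1 `<=` below c2.

Lemma aboveP c j : above c j <-> ~ below c j.
Proof.
split=> [aj bj|nbj].
  by have: (below c `&` above c) j by []; rewrite cut_disjoint.
have: (below c `|` above c) j by rewrite cut_cover.
by case.
Qed.

Lemma cut_eq c1 c2 : below c1 = below c2 -> c1 = c2.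
Proof.
move=> eb; have ea : above c1 = above c2.
  by apply/seteqP; split=> j /aboveP; rewrite ?eb => nb; apply/aboveP; rewrite ?eb.
case: c1 c2 eb ea => [K L p q r] [K' L' p' q' r'] /= eK eL.
by subst; congr Cut; exact: Prop_irrelevance.
Qed.

Lemma below_le c j k : below c k -> j <= k -> below c j.
Proof.
move=> bk jk; apply: contrapT => /aboveP aj.
by have := cut_sorted bk aj; rewrite ltNge jk.
Qed.

Lemma cut_ltP c1 c2 : cut_lt c1 c2 <-> exists2 j, above c1 j & below c2 j.
Proof.
split=> [[_ /existsNP[j /not_implyP[bj nbj]]]|[j /aboveP aj bj]].
  by exists j => //; apply/aboveP.
split=> [k bk|/(_ j bj)//]; case: (leP k j) => [|/ltW jk]; first exact: below_le.
by case: aj; exact: below_le jk.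
Qed.

Lemma cut_leNgt c1 c2 : cut_le c1 c2 <-> ~ cut_lt c2 c1.
Proof.
split=> [le /cut_ltP[j /aboveP aj /le]//|nlt j bj].
by apply: contrapT => /aboveP aj; apply: nlt; apply/cut_ltP; exists j.
Qed.

Lemma cut_ltNge c1 c2 : cut_lt c1 c2 <-> ~ cut_le c2 c1.
Proof. by split=> [lt /cut_leNgt//|nle]; apply: contrapT => /cut_leNgt. Qed.

Lemma cut_ltW c1 c2 : cut_lt c1 c2 -> cut_le c1 c2.
Proof. by case. Qed.

Lemma cut_lexx c : cut_le c c.
Proof. by []. Qed.

Lemma cut_le_trans c2 c1 c3 : cut_le c1 c2 -> cut_le c2 c3 -> cut_le c1 c3.
Proof. by move=> le12 le23 j /le12/le23. Qed.

Lemma cut_lt_le_trans c2 c1 c3 : cut_lt c1 c2 -> cut_le c2 c3 -> cut_lt c1 c3.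
Proof. by move=> /cut_ltP[j aj bj] le23; apply/cut_ltP; exists j => //; exact: le23. Qed.

Lemma cut_le_lt_trans c2 c1 c3 : cut_le c1 c2 -> cut_lt c2 c3 -> cut_lt c1 c3.
Proof.
move=> le12 /cut_ltP[j /aboveP aj bj]; apply/cut_ltP; exists j => //.
by apply/aboveP => /le12.
Qed.

Lemma cut_le_anti c1 c2 : cut_le c1 c2 -> cut_le c2 c1 -> c1 = c2.
Proof. by move=> le12 le21; apply: cut_eq; apply/seteqP. Qed.

Lemma cut_le_total c1 c2 : cut_le c1 c2 \/ cut_le c2 c1.
Proof. by case: (pselect (cut_lt c1 c2)) => [/cut_ltW|/cut_leNgt]; [left|right]. Qed.

Lemma cut_le_eqVlt c1 c2 : cut_le c1 c2 -> c1 = c2 \/ cut_lt c1 c2.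
Proof.
move=> le12; case: (pselect (cut_lt c1 c2)) => [|/cut_leNgt]; first by right.
by left; exact: cut_le_anti.
Qed.

Lemma cmin_le c : cut_le cmin c.
Proof. by []. Qed.

Lemma cmax_ge c : cut_le c cmax.
Proof. by []. Qed.

Lemma cmin_lt c : c <> cmin -> cut_lt cmin c.
Proof. by move=> ncm; case: (cut_le_eqVlt (cmin_le c)) => // /esym. Qed.

Lemma cmax_gt c : c <> cmax -> cut_lt c cmax.
Proof. by move=> ncm; case: (cut_le_eqVlt (cmax_ge (c := c))). Qed.

Lemma le_cut_before c j : cut_le c (cut_before j) <-> above c j.
Proof.
split=> [le|aj i bi]; last exact: cut_sorted bi aj.
by apply/aboveP => /le /=; rewrite ltxx.
Qed.

Lemma cut_after_le c j : cut_le (cut_after j) c <-> below c j.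
Proof.
by split=> [|bj i /= ij]; [apply; rewrite /= lexx|exact: below_le bj ij].
Qed.

Lemma lt_cut_after c j : cut_lt c (cut_after j) <-> above c j.
Proof. by rewrite cut_ltNge cut_after_le aboveP. Qed.

Lemma cut_before_lt c j : cut_lt (cut_before j) c <-> below c j.
Proof. by rewrite cut_ltNge le_cut_before aboveP; split=> [/contrapT|?]. Qed.

Lemma before_lt_after j : cut_lt (cut_before j) (cut_after j).
Proof. by apply/cut_before_lt; rewrite /= lexx. Qed.

Lemma cut_succ_ba j : cut_succ (cut_before j) (cut_after j).
Proof.
split; first exact: before_lt_after.
by case=> e [/cut_before_lt bj /lt_cut_after/aboveP].
Qed.

(** A position separating [c1] from [c2] puts both of its adjacent cuts between them, so having
    nothing strictly in between forces equality. Hence jumps of the cut order come exactly from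
    positions. *)
Lemma cut_succP c1 c2 :
  cut_succ c1 c2 <-> exists2 j, c1 = cut_before j & c2 = cut_after j.
Proof.
split=> [[/cut_ltP[j aj bj] nbetw]|[j -> ->]]; last exact: cut_succ_ba.
have [le1 le2] : cut_le c1 (cut_before j) /\ cut_le (cut_after j) c2.
  by split; [apply/le_cut_before|apply/cut_after_le].
exists j; [have [//|lt] := cut_le_eqVlt le1|have [//|lt] := cut_le_eqVlt le2].
- by case: nbetw; exists (cut_before j); split=> //; apply/cut_before_lt.
- by case: nbetw; exists (cut_after j); split=> //; apply/lt_cut_after.
Qed.

Lemma has_predP c : has_pred c <-> exists j, c = cut_after j.
Proof.
split=> [[c' /cut_succP[j _ ->]]|[j ->]]; first by exists j.
by exists (cut_before j); exact: cut_succ_ba.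
Qed.

Lemma has_succP c : has_succ c <-> exists j, c = cut_before j.
Proof.
split=> [[c' /cut_succP[j -> _]]|[j ->]]; first by exists j.
by exists (cut_after j); exact: cut_succ_ba.
Qed.

Lemma cut_after_neq_cmin j : cut_after j <> cmin.
Proof. by move=> /(congr1 (fun c => below c j)) /=; rewrite lexx => <-. Qed.

Lemma cut_before_neq_cmax j : cut_before j <> cmax.
Proof. by move=> e; have : below (cut_before j) j; [rewrite e|rewrite /= ltxx]. Qed.

Lemma cut_after_inj : injective (@cut_after d J).
Proof.
move=> i j eij; apply: le_anti; apply/andP; split.
  by have : below (cut_after j) i by rewrite -eij /=.
by have : below (cut_after i) j by rewrite eij /=.
Qed.

Lemma cut_before_inj : injective (@cut_before d J).
Proof.
move=> i j eij; apply: le_anti; apply/andP; split.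
  by have : above (cut_before i) j by rewrite eij /=.
by have : above (cut_before j) i by rewrite -eij /=.
Qed.

(** The supremum has as lower part the union of the lower parts of the members of [S]; for empty [S]
    this is [cmin]. *)
Lemma cut_sup (S : set (cut J)) : exists s : cut J,
  (forall c, S c -> cut_le c s) /\ (forall c, cut_lt c s -> exists2 e, S e & cut_lt c e).
Proof.
pose K := [set j | exists2 c, S c & below c j].
have sK k l : K k -> ~ K l -> k < l.
  move=> [c Sc bk] nKl; rewrite ltNge; apply/negP => lk.
  by apply: nKl; exists c => //; exact: below_le bk lk.
exists (Cut (setUv K) (setICr K) sK); split=> [c Sc j bj|c /cut_ltP[j aj [e Se bj]]].
  by exists c.
by exists e => //; apply/cut_ltP; exists j.
Qed.

(** Since [P] passes over jumps, into left limits and a little beyond right limits, the supremum of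
    the cuts up to which it holds can only be [cmax]. *)
Lemma cut_ind_up (e : cut J) (P : cut J -> Prop) :
    P e ->
    (forall j, cut_le e (cut_before j) -> P (cut_before j) -> P (cut_after j)) ->
    (forall c, cut_lt e c -> ~ has_pred c ->
       (forall c', cut_le e c' -> cut_lt c' c -> P c') -> P c) ->
    (forall c, cut_le e c -> c <> cmax -> ~ has_succ c -> P c ->
       exists2 u, cut_lt c u & forall c', cut_lt c c' -> cut_lt c' u -> P c') ->
  forall c, cut_le e c -> P c.
Proof.
move=> Pe Ps Pl Pr.
pose S := [set c | cut_le e c /\ forall c', cut_le e c' -> cut_le c' c -> P c'].
have Se : S e by split=> // c' le1 le2; rewrite -(cut_le_anti le1 le2).
have [s [ubs lubs]] := cut_sup S; have les := ubs _ Se.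
have Plt c : cut_le e c -> cut_lt c s -> P c.
  by move=> ec /lubs[u [_ Pu] /cut_ltW/Pu]; exact.
have Ps' : P s.
  have [<-//|lts] := cut_le_eqVlt les.
  have [/has_predP[j sj]|np] := pselect (has_pred s); last exact: Pl.
  have ej : cut_le e (cut_before j).
    by apply/le_cut_before; apply/lt_cut_after; rewrite -sj.
  by rewrite sj; apply: Ps => //; apply: Plt => //; rewrite sj; exact: before_lt_after.
have Ple c : cut_le e c -> cut_le c s -> P c.
  by move=> ec /cut_le_eqVlt[->//|]; exact: Plt.
have [smax|nsmax] := pselect (s = cmax).
  by move=> c ec; apply: Ple => //; rewrite smax.
(* Such a [u] would belong to [S] and lie above its supremum [s]. *)
suff [u su Pu] : exists2 u, cut_lt s u & forall c, cut_lt s c -> cut_le c u -> P c.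
  have /cut_ltNge[] := su; apply: ubs.
  split=> [|c ec cu]; first exact: cut_le_trans les (cut_ltW su).
  have [lt|/cut_leNgt] := pselect (cut_lt s c); first exact: Pu.
  exact: Ple.
have [/has_succP[j sj]|ns] := pselect (has_succ s).
  exists (cut_after j); first by rewrite sj; exact: before_lt_after.
  move=> c; rewrite sj => /cut_before_lt /cut_after_le lt1 lt2.
  by rewrite -(cut_le_anti lt1 lt2); apply: Ps; rewrite -sj.
have [u su Pu] := Pr s les nsmax ns Ps'.
(* [Pr] says nothing at [u] itself; as [s] has no successor, there is room for a smaller bound [v]
   that may be included. *)
have [v [sv vu]] : exists v, cut_lt s v /\ cut_lt v u.
  by apply: contrapT => nv; apply: ns; exists u.
by exists v => // c sc cv; apply: Pu => //; exact: cut_le_lt_trans vu.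
Qed.

End CutOrder.

(** * Reversal of the order *)

Section Mirror.
Context {d : Order.disp_t} {J : orderType d}.
Implicit Types c e : cut J.

Fact mirror_cover c : above c `|` below c = setT.
Proof. by rewrite setUC cut_cover. Qed.

Fact mirror_disjoint c : above c `&` below c = set0.
Proof. by rewrite setIC cut_disjoint. Qed.

Definition mirror c : cut J^d :=
  @Cut _ J^d (above c) (below c) (mirror_cover c) (mirror_disjoint c)
    (fun k l ak bl => cut_sorted bl ak).

Fact unmirror_cover (c : cut J^d) : @setU J (above c) (below c) = setT.
Proof. by rewrite setUC; exact: (cut_cover c). Qed.

Fact unmirror_disjoint (c : cut J^d) : @setI J (above c) (below c) = set0.
Proof. by rewrite setIC; exact: (cut_disjoint c). Qed.

(** A separate inverse leads back to [cut J], whereas a second [mirror] would give cuts of the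
    double dual. *)
Definition unmirror (c : cut J^d) : cut J :=
  @Cut _ J (above c) (below c) (unmirror_cover c) (unmirror_disjoint c)
    (fun k l ak bl => cut_sorted bl ak).

Lemma mirrorK : cancel mirror unmirror.
Proof. by move=> c; exact: cut_eq. Qed.

Lemma unmirrorK : cancel unmirror mirror.
Proof. by move=> c; exact: cut_eq. Qed.

Lemma mirror_lt c1 c2 : cut_lt (mirror c1) (mirror c2) <-> cut_lt c2 c1.
Proof. by split=> /cut_ltP[j aj bj]; apply/cut_ltP; exists j. Qed.

Lemma mirror_le c1 c2 : cut_le (mirror c1) (mirror c2) <-> cut_le c2 c1.
Proof. by rewrite !cut_leNgt mirror_lt. Qed.

Lemma mirror_cmin : mirror cmin = cmax.
Proof. exact: cut_eq. Qed.

Lemma mirror_cmax : mirror cmax = cmin.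
Proof. exact: cut_eq. Qed.

Lemma mirror_before j : mirror (cut_before j) = @cut_after _ J^d j.
Proof. exact: cut_eq. Qed.

Lemma mirror_after j : mirror (cut_after j) = @cut_before _ J^d j.
Proof. exact: cut_eq. Qed.

Lemma mirror_has_pred c : has_pred (mirror c) <-> has_succ c.
Proof.
rewrite has_predP has_succP; split=> -[j]; last by move->; exists j; exact: mirror_before.
by rewrite -mirror_before => /(can_inj mirrorK) ->; exists j.
Qed.

Lemma mirror_has_succ c : has_succ (mirror c) <-> has_pred c.
Proof.
rewrite has_predP has_succP; split=> -[j]; last by move->; exists j; exact: mirror_after.
by rewrite -mirror_after => /(can_inj mirrorK) ->; exists j.
Qed.

Lemma lim_mirror (Q : finType) (rho : cut J -> Q) c :
  lim_left (rho \o unmirror) (mirror c) = lim_right rho c /\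
  lim_right (rho \o unmirror) (mirror c) = lim_left rho c.
Proof.
split; apply/setP => q; rewrite !inE; apply: asbool_equiv_eq; split=> lim c' lt.
- have [e [lt1 lt2 <-]] := lim (mirror c') ((mirror_lt _ _).2 lt).
  by exists (unmirror e); split=> //; apply/mirror_lt; rewrite unmirrorK.
- have [|e [/mirror_lt lt1 /mirror_lt lt2 <-]] := lim (unmirror c').
    by apply/mirror_lt; rewrite unmirrorK.
  by exists (mirror e); rewrite /= mirrorK -[c']unmirrorK.
- have [e [lt1 lt2 <-]] := lim (mirror c') ((mirror_lt _ _).2 lt).
  by exists (unmirror e); split=> //; apply/mirror_lt; rewrite unmirrorK.
- have [|e [/mirror_lt lt1 /mirror_lt lt2 <-]] := lim (unmirror c').
    by apply/mirror_lt; rewrite unmirrorK.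
  by exists (mirror e); rewrite /= mirrorK -[c']unmirrorK.
Qed.

Definition lim_left_mirror Q rho c := (@lim_mirror Q rho c).1.
Definition lim_right_mirror Q rho c := (@lim_mirror Q rho c).2.

End Mirror.

(** This is upward induction on the reversed order, carried over by [mirror]. *)
Lemma cut_ind_down d (J : orderType d) (e : cut J) (P : cut J -> Prop) :
    P e ->
    (forall j, cut_le (cut_after j) e -> P (cut_after j) -> P (cut_before j)) ->
    (forall c, cut_lt c e -> ~ has_succ c ->
       (forall c', cut_lt c c' -> cut_le c' e -> P c') -> P c) ->
    (forall c, cut_le c e -> c <> cmin -> ~ has_pred c -> P c ->
       exists2 u, cut_lt u c & forall c', cut_lt u c' -> cut_lt c' c -> P c') ->
  forall c, cut_le c e -> P c.
Proof.
move=> Pe Ps Pl Pr c ce; rewrite -[c]mirrorK.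
apply: (@cut_ind_up _ J^d (mirror e) (P \o unmirror)); last by apply/mirror_le.
- by rewrite /= mirrorK.
- move=> j; rewrite -mirror_after -mirror_before /= !mirrorK => /mirror_le.
  exact: Ps.
- move=> c1; rewrite -[c1]unmirrorK mirror_lt mirror_has_pred /= mirrorK => lt np IH.
  apply: Pl => // c' /mirror_lt; rewrite -mirror_le => lt1 le1.
  by have := IH _ le1 lt1; rewrite /= mirrorK.
- move=> c1; rewrite -[c1]unmirrorK mirror_le mirror_has_succ /= mirrorK => le1 nm np Pc.
  have [|u lt Pu] := Pr _ le1 _ np Pc.
    by move=> e1; apply: nm; rewrite e1 mirror_cmin.
  exists (mirror u); first by apply/mirror_lt.
  by move=> c'; rewrite -[c']unmirrorK !mirror_lt mirrorK => *; exact: Pu.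
Qed.

(** Finiteness of [Q] is the point: each state outside the limit set is missing from some interval
    below [c], and the largest of finitely many lower bounds serves all of them at once. *)
Lemma lim_leftP d (J : orderType d) (Q : finType) (rho : cut J -> Q) (c : cut J)
    (P : Q -> Prop) : c <> cmin ->
  (forall q, q \in lim_left rho c -> P q) <->
  exists2 u, cut_lt u c & forall e, cut_lt u e -> cut_lt e c -> P (rho e).
Proof.
move=> nc; split=> [PQ|[u uc Pu] q]; last first.
  by rewrite inE => /asboolP/(_ u uc)[e [ue ec <-]]; exact: Pu.
(* The claim is restricted to the states of a list, which grows to all of [Q]; for the empty list
   [cmin] is a bound. *)
have [u uc Pu] : exists2 u, cut_lt u c & forall e, cut_lt u e -> cut_lt e c ->
    rho e \in enum Q -> P (rho e).
  elim: (enum Q) => [|q s [u uc Pu]]; first by exists cmin => //; exact: cmin_lt.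
  have [ql|] := pselect (q \in lim_left rho c).
    exists u => // e ue ec; rewrite inE => /orP[/eqP->|]; [exact: PQ|exact: Pu].
  rewrite inE asboolE => /existsNP[w /not_implyP[wc nw]].
  have nq e : cut_lt w e -> cut_lt e c -> rho e != q.
    by move=> we ec; apply/eqP => eq; apply: nw; exists e.
  have [uw|wu] := cut_le_total u w; [exists w => //|exists u => //] => e lte ec.
    rewrite inE (negPf (nq _ lte ec)); apply: Pu => //; exact: cut_le_lt_trans lte.
  rewrite inE (negPf (nq _ (cut_le_lt_trans wu lte) ec)); exact: Pu.
by exists u => // e ue ec; apply: Pu => //; rewrite mem_enum.
Qed.

Lemma lim_rightP d (J : orderType d) (Q : finType) (rho : cut J -> Q) (c : cut J)
    (P : Q -> Prop) : c <> cmax ->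
  (forall q, q \in lim_right rho c -> P q) <->
  exists2 u, cut_lt c u & forall e, cut_lt c e -> cut_lt e u -> P (rho e).
Proof.
move=> nc; rewrite -lim_left_mirror lim_leftP; last first.
  by rewrite -mirror_cmax => /(can_inj mirrorK).
split=> -[u cu Pu].
  exists (unmirror u); first by apply/mirror_lt; rewrite unmirrorK.
  move=> e /mirror_lt ce /mirror_lt; rewrite unmirrorK => ue.
  by have := Pu _ ue ce; rewrite /= mirrorK.
exists (mirror u); first by apply/mirror_lt.
by move=> e; rewrite -[e]unmirrorK /= !mirrorK => /mirror_lt ue /mirror_lt ec; exact: Pu.
Qed.

(** If no limit state is sent to [q], then [lim_leftP] gives an interval below [c] on which
    [g \o rho] avoids [q]. With [g] a projection this splits the limit sets of a product run. *)
Lemma lim_left_comp d (J : orderType d) (Q Q' : finType) (g : Q -> Q')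
    (rho : cut J -> Q) (c : cut J) : c <> cmin ->
  lim_left (g \o rho) c = (g @: lim_left rho c)%SET.
Proof.
move=> nc; apply/setP => q; apply/idP/imsetP => [|[p pl ->]]; last first.
  move: pl; rewrite !inE => /asboolP lim; apply/asboolP => u /lim[e [ue ec <-]].
  by exists e.
move=> ql; apply: contrapT => npl.
have [u uc Pu] : exists2 u, cut_lt u c &
    forall e, cut_lt u e -> cut_lt e c -> g (rho e) <> q.
  by apply/(lim_leftP rho (fun p => g p <> q) nc) => p pl gp; apply: npl; exists p.
by move: ql; rewrite inE => /asboolP/(_ u uc)[e [ue ec]]; exact: Pu.
Qed.

Lemma lim_right_comp d (J : orderType d) (Q Q' : finType) (g : Q -> Q')
    (rho : cut J -> Q) (c : cut J) : c <> cmax ->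
  lim_right (g \o rho) c = (g @: lim_right rho c)%SET.
Proof.
move=> nc; rewrite -!lim_left_mirror -lim_left_comp // -mirror_cmax.
by move=> /(can_inj mirrorK).
Qed.

(** * Transductions computed by automata, and their closure properties *)

Definition transduction (S G : Type) :=
  forall d (J : orderType d), (J -> S) -> J -> G.

(** The automaton is chosen before the ordering, so a single one serves all lengths. *)
Definition computable (S G : finType) (f : transduction S G) : Prop :=
  exists A : automaton S G, forall d (J : orderType d) (x : J -> S),
    (exists (rho : cut J -> state A) y, accepting_run x rho y) /\
    (forall (rho : cut J -> state A) y, accepting_run x rho y -> y = f d J x).

Section Combinators.
Variables S S' G G' H : finType.

Definition map_automaton (h : S -> G) : automaton S G := {|
  state := unit;
  succ_trans := finset (fun t : unit * S * G * unit => t.1.2 == h t.1.1.2);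
  left_lim_trans := finset (fun=> true);
  right_lim_trans := finset (fun=> true);
  init := finset (fun=> true);
  final := finset (fun=> true) |}.

Lemma computable_map (h : S -> G) : computable (fun d (J : orderType d) x => h \o x).
Proof.
exists (map_automaton h) => d J x; split.
  by exists (fun=> tt), (h \o x); split=> *; rewrite ?inE /=.
by move=> rho y [_ run _ _]; apply/funext => j; have := run j; rewrite inE => /eqP.
Qed.

Definition mirror_automaton (A : automaton S G) : automaton S G := {|
  succ_trans := finset (fun t => (t.2, t.1.1.2, t.1.2, t.1.1.1) \in succ_trans A);
  left_lim_trans := finset (fun t => (t.2, t.1) \in right_lim_trans A);
  right_lim_trans := finset (fun t => (t.2, t.1) \in left_lim_trans A);
  init := final A;
  final := init A |}.

Lemma mirror_run (A : automaton S G) d (J : orderType d) (x : J -> S)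
    (rho : cut J -> state A) y :
  @accepting_run _ J _ _ (mirror_automaton A) x rho y <->
  @accepting_run _ J^d _ _ A x (rho \o unmirror) y.
Proof.
split=> -[[rmin rmax] rsucc rleft rright].
  split.
  - by rewrite -mirror_cmin -mirror_cmax /= !mirrorK.
  - move=> j; rewrite -mirror_before -mirror_after /= !mirrorK.
    by have := rsucc j; rewrite inE.
  - move=> c; rewrite -[c]unmirrorK lim_left_mirror mirror_has_pred /= mirrorK.
    move=> nc ns; have := rright (unmirror c); rewrite inE; apply=> //.
    by move=> e; apply: nc; rewrite e mirror_cmax.
  - move=> c; rewrite -[c]unmirrorK lim_right_mirror mirror_has_succ /= mirrorK.
    move=> nc ns; have := rleft (unmirror c); rewrite inE; apply=> //.
    by move=> e; apply: nc; rewrite e mirror_cmin.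
split.
- by move: rmin rmax; rewrite -mirror_cmin -mirror_cmax /= !mirrorK.
- by move=> j; have := rsucc j; rewrite -mirror_before -mirror_after /= !mirrorK inE.
- move=> c nc np; have := rright (mirror c).
  rewrite lim_right_mirror mirror_has_succ /= mirrorK inE; apply=> //.
  by rewrite -mirror_cmin => /(can_inj mirrorK).
- move=> c nc np; have := rleft (mirror c).
  rewrite lim_left_mirror mirror_has_pred /= mirrorK inE; apply=> //.
  by rewrite -mirror_cmax => /(can_inj mirrorK).
Qed.

Lemma computable_mirror (f : transduction S G) :
  computable f -> computable (fun d (J : orderType d) => f _ J^d).
Proof.
move=> [A fA]; exists (mirror_automaton A) => d J x.
have [[rho [y run]] uniq] := fA _ J^d x; split; last first.
  by move=> rho' y' /mirror_run/uniq.
exists (rho \o mirror), y; apply/mirror_run.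
by congr accepting_run: run; apply/funext => c /=; rewrite unmirrorK.
Qed.

Section Combine.
Variables (A : automaton S G) (B : automaton S' G').
Variables (g : S -> G -> S') (h : G -> G' -> H).

(** A cascade of [A] and [B]. Their outputs need not be kept in the states, since both are consumed
    within one successor transition; testing limit sets through projections suffices by
    [lim_left_comp] and [lim_right_comp]. *)
Definition combine : automaton S H := {|
  state := (state A * state B)%type;
  succ_trans := finset (fun t : state A * state B * S * H * (state A * state B) =>
    [exists b, exists b', [&& (t.1.1.1.1, t.1.1.2, b, t.2.1) \in succ_trans A,
      (t.1.1.1.2, g t.1.1.2 b, b', t.2.2) \in succ_trans B & t.1.2 == h b b']]);
  left_lim_trans := finset (fun t : {set state A * state B} * (state A * state B) =>
    (((fst @: t.1)%SET, t.2.1) \in left_lim_trans A) &&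
    (((snd @: t.1)%SET, t.2.2) \in left_lim_trans B));
  right_lim_trans := finset (fun t : state A * state B * {set state A * state B} =>
    ((t.1.1, (fst @: t.2)%SET) \in right_lim_trans A) &&
    ((t.1.2, (snd @: t.2)%SET) \in right_lim_trans B));
  init := finset (fun q => (q.1 \in init A) && (q.2 \in init B));
  final := finset (fun q => (q.1 \in final A) && (q.2 \in final B)) |}.

Lemma combine_run d (J : orderType d) (x : J -> S)
    (rho : cut J -> state A * state B) z :
  accepting_run (A := combine) x rho z <->
  exists y y', [/\ accepting_run x (fst \o rho) y,
    accepting_run (fun j => g (x j) (y j)) (snd \o rho) y' &
    z = fun j => h (y j) (y' j)].
Proof.
split=> [[[]]|[y [y' [[[mA MA] sA lA rA] [[mB MB] sB lB rB] ->]]]].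
  rewrite !inE => /andP[mA mB] /andP[MA MB] run_s run_l run_r.
  (* The outputs of the components are only known to exist position by position; choice assembles
     them into two words. *)
  have /choice[f fP] : forall j, exists b : G * G',
      [/\ ((rho (cut_before j)).1, x j, b.1, (rho (cut_after j)).1) \in succ_trans A,
      ((rho (cut_before j)).2, g (x j) b.1, b.2, (rho (cut_after j)).2)
        \in succ_trans B & z j = h b.1 b.2].
    move=> j; have := run_s j; rewrite inE /=.
    by case/existsP=> b /existsP[b' /and3P[bA bB /eqP zE]]; exists (b, b').
  exists (fun j => (f j).1), (fun j => (f j).2); split.
  - split=> // [j|c nc np|c nc ns]; first by case: (fP j).
      by have := run_l c nc np; rewrite inE lim_left_comp // => /andP[].
    by have := run_r c nc ns; rewrite inE lim_right_comp // => /andP[].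
  - split=> // [j|c nc np|c nc ns]; first by case: (fP j).
      by have := run_l c nc np; rewrite inE lim_left_comp // => /andP[].
    by have := run_r c nc ns; rewrite inE lim_right_comp // => /andP[].
  - by apply/funext => j; case: (fP j).
split.
- by rewrite !inE; split; apply/andP.
- move=> j; rewrite inE /=; apply/existsP; exists (y j); apply/existsP; exists (y' j).
  by rewrite sA sB eqxx.
- move=> c nc np; rewrite inE /= -!lim_left_comp //.
  by apply/andP; split; [exact: lA|exact: lB].
- move=> c nc ns; rewrite inE /= -!lim_right_comp //.
  by apply/andP; split; [exact: rA|exact: rB].
Qed.

End Combine.

(** All accepting runs of [A] have the same output, so [B] reads the same word in every run of the
    cascade. Suitable [g] and [h] give both composition and pairing. *)
Lemma computable_combine (f : transduction S G) (f' : transduction S' G')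
    (g : S -> G -> S') (h : G -> G' -> H) :
  computable f -> computable f' ->
  computable (fun d (J : orderType d) x j =>
    h (f d J x j) (f' d J (fun i => g (x i) (f d J x i)) j)).
Proof.
move=> [A fA] [B fB]; exists (combine A B g h) => d J x.
have [[rho [y runA]] uniqA] := fA d J x; split.
  have [[rho' [y' runB]] _] := fB d J (fun i => g (x i) (y i)).
  exists (fun c => (rho c, rho' c)), (fun j => h (y j) (y' j)).
  by apply/combine_run; exists y, y'.
move=> rhoAB z /combine_run[y1 [y2 [/uniqA-> runB ->]]].
by have [_ /(_ _ _ runB)->] := fB d J (fun j => g (x j) (f d J x j)).
Qed.

End Combinators.

Lemma computable_comp (S G H : finType) (f : transduction S G) (f' : transduction G H) :
  computable f -> computable f' ->
  computable (fun d (J : orderType d) x => f' d J (f d J x)).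
Proof. exact: (computable_combine (fun _ b => b) (fun _ b => b)). Qed.

Lemma computable_pair (S G G' : finType) (f : transduction S G) (f' : transduction S G') :
  computable f -> computable f' ->
  computable (fun d (J : orderType d) x j => (f d J x j, f' d J x j)).
Proof. exact: (computable_combine (fun a _ => a) pair). Qed.

(** * One construction for [until] and [stavi_until], selected by the flag [is_until] *)

Section Reach.
Variable is_until : bool.

Section Semantics.
Context {d : Order.disp_t} {J : orderType d}.
Variable x : J -> bool * bool.
Implicit Types (c e w : cut J) (j k : J).

Let connective : set J -> set J -> set J :=
  if is_until then until else stavi_until.

(** Only the requirements on the cut itself are kept; the one on the first operand between the
    current position and the cut goes into [reaches]. *)
Definition target c : Prop :=
  if is_until then exists2 j, c = cut_before j & (x j).2
  else [/\ gap c,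
    forall k, above c k -> exists j, [/\ above c j, j < k & ~ (x j).1]
    & exists k, above c k /\ forall j, above c j -> j < k -> (x j).2].

(** Equality of [e] and [c] is allowed: if [j] immediately follows [i], then [cut_after i] and
    [cut_before j] coincide. *)
Definition reaches e : Prop := exists c,
  [/\ target c, cut_le e c & forall j, above e j -> below c j -> (x j).1].

Lemma connectiveP i :
  connective [set j | (x j).1] [set j | (x j).2] i <-> reaches (cut_after i).
Proof.
rewrite /connective /reaches /target; case: is_until; split.
- move=> [j [ij P2 P1]]; exists (cut_before j); split=> //; first by exists j.
  exact/le_cut_before.
- by move=> [_ [[j -> P2] /le_cut_before ij P1]]; exists j.
- move=> [c [[gc bi] P1 n1 P2]]; exists c; split=> //; exact/cut_after_le.
- by move=> [c [[gc n1 P2] /cut_after_le bi P1]]; exists c.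
Qed.

Definition limit c : Prop := c <> cmin /\ ~ has_pred c.

(** States sit on cuts, so a failure of [R] at [j] is recorded on the cut just after [j]; limit sets
    can then detect whether failures accumulate. *)
Definition after_not (R : J -> bool) c : Prop :=
  exists2 j, c = cut_after j & ~~ R j.

Lemma after_not_after R j : after_not R (cut_after j) <-> ~~ R j.
Proof. by split=> [[k /cut_after_inj->]//|nR]; exists j. Qed.

Lemma after_not_pred R c : ~ has_pred c -> ~ after_not R c.
Proof. by move=> np [j cE _]; apply: np; apply/has_predP; exists j. Qed.

(** As [c] has no successor, [cut_before k] is strictly above [c] for every position [k] above it,
    so intervals of positions and of cuts to the right of [c] bound each other. *)
Lemma right_limitP R c : ~ has_succ c ->
  (exists2 w, cut_lt c w & forall e, cut_lt c e -> cut_lt e w -> ~ after_not R e) <->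
  exists k, above c k /\ forall j, above c j -> j < k -> R j.
Proof.
move=> ns; split=> [[w /cut_ltP[k ak bk] nR]|[k [ak Rk]]].
  exists k; split=> // j aj jk; apply: contrapT => /negP; rewrite -after_not_after.
  apply: nR; first exact/lt_cut_after.
  apply: (@cut_le_lt_trans _ _ (cut_before k)); first exact/cut_after_le.
  exact/cut_before_lt.
exists (cut_before k).
  have [cE|//] : c = cut_before k \/ cut_lt c (cut_before k).
    by apply: cut_le_eqVlt; apply/le_cut_before.
  by case: ns; apply/has_succP; exists k.
move=> e ce ek [j eE /negP]; apply; apply: Rk; first by apply/lt_cut_after; rewrite -eE.
by apply: (@cut_ltW _ _ _ _ ek j); rewrite eE /=.
Qed.

(** This is the form a right limit transition can test: the right limit set shows whether failures
    accumulate from above, and [limit] is what remains of [gap]. *)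
Lemma targetF c : is_until = false -> c <> cmax -> ~ has_succ c ->
  target c <-> [/\ limit c,
    ~ exists2 w, cut_lt c w & forall e, cut_lt c e -> cut_lt e w ->
        ~ after_not (fun j => (x j).1) e
    & exists2 w, cut_lt c w & forall e, cut_lt c e -> cut_lt e w ->
        ~ after_not (fun j => (x j).2) e].
Proof.
move=> nuntil nmax ns; rewrite /target nuntil !(propext (right_limitP _ ns)); split.
  move=> [[nmin _ _ np] n1 P2]; split=> // -[k [/n1[j [aj jk nP]] P1]].
  by apply: nP; exact: P1.
move=> [[nmin np] n1 P2]; split=> // k ak; apply: contrapT => nj; apply: n1.
by exists k; split=> // j aj jk; apply: contrapT => nP; apply: nj; exists j.
Qed.

Lemma target_before j : target (cut_before j) <-> is_until && (x j).2.
Proof.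
rewrite /target; case: is_until => /=.
  by split=> [[k /cut_before_inj->]|]; last exists j.
by split=> // -[[_ _ ns _]]; case: ns; apply/has_succP; exists j.
Qed.

Lemma target_nsucc c : is_until -> ~ has_succ c -> ~ target c.
Proof. by rewrite /target => -> ns [j cE _]; apply: ns; apply/has_succP; exists j. Qed.

Lemma target_cmax : ~ target cmax.
Proof.
rewrite /target; case: is_until => [[j /esym/cut_before_neq_cmax]//|[[]]//].
Qed.

Let P1 j := (x j).1.

(* At a left limit [c] nothing is required when P1 fails arbitrarily close below.
   Otherwise [c] may fail to reach a target although all cuts just below it do, but
   only if those targets accumulate at [c]. *)
Definition backward (V : cut J -> Prop) : Prop := [/\ ~ V cmax,
  forall j, V (cut_before j) <-> target (cut_before j) \/ (P1 j /\ V (cut_after j)),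
  forall c, c <> cmax -> ~ has_succ c ->
    (V c <-> target c \/ exists2 w, cut_lt c w &
      forall e, cut_lt c e -> cut_lt e w -> V e /\ ~ after_not P1 e)
  & forall c, c <> cmin -> ~ has_pred c ->
    (exists2 w, cut_lt w c & forall e, cut_lt w e -> cut_lt e c -> ~ after_not P1 e) ->
    (V c -> exists2 w, cut_lt w c & forall e, cut_lt w e -> cut_lt e c -> V e) /\
    ((exists2 w, cut_lt w c & forall e, cut_lt w e -> cut_lt e c -> V e /\ ~ target e) ->
      V c)].

Lemma backward_reaches : backward reaches.
Proof.
split.
- move=> [c [tc /cut_leNgt nlt _]]; have [cE|/cmax_gt//] := pselect (c = cmax).
  by move: tc; rewrite cE; exact: target_cmax.
- move=> j; split=> [[c [tc le P]]|[tj|[Pj [c [tc le P]]]]].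
  + have [->|/cut_before_lt bj] := cut_le_eqVlt le; [by left|right].
    split; first by apply: P; rewrite //= lexx.
    exists c; split=> //; first exact/cut_after_le.
    by move=> k /= jk; apply: P; rewrite /= ltW.
  + by exists (cut_before j); split=> // k /aboveP.
  + exists c; split=> //; first exact: cut_le_trans (cut_ltW (before_lt_after j)) le.
    move=> k /=; rewrite le_eqVlt => /orP[/eqP<-//|]; exact: P.
- move=> c nmax ns; split=> [[w [tw le P]]|[tc|[w cw VP]]].
  + have [->|lt] := cut_le_eqVlt le; [by left|right].
    exists w => // e ce ew; split.
      exists w; split=> //; first exact: cut_ltW.
      by move=> j ej; apply: P; move: ej; rewrite !aboveP => nb /(cut_ltW ce).
    move=> [j eE /negP]; apply; apply: P; first by apply/lt_cut_after; rewrite -eE.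
    by apply/cut_after_le; rewrite -eE; exact: cut_ltW.
  + by exists c; split=> // k /aboveP.
  (* The target of any such [e] serves [c] too: up to [e] the first operand holds because no failure
     is marked, and beyond [e] because [e] reaches that target. *)
  + have [e [ce ew]] : exists e, cut_lt c e /\ cut_lt e w.
      by apply: contrapT => ne; apply: ns; exists w.
    have [[u [tu eu P]] _] := VP e ce ew.
    exists u; split=> //; first exact: cut_le_trans (cut_ltW ce) eu.
    move=> j cj uj; have [ej|/aboveP] := pselect (below e j); last by move/P; exact.
    apply: contrapT => /negP nP.
    have [] := VP (cut_after j); [exact/lt_cut_after| |by move=> _ []; exists j].
    by apply: cut_le_lt_trans ew; apply/cut_after_le.
- move=> c nmin np [w wc nP]; have Pw j : above w j -> below c j -> P1 j.
    move=> aj bj; apply: contrapT => /negP nPj; apply: (nP (cut_after j)).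
    + exact/lt_cut_after.
    + have /cut_le_eqVlt[cE|//] : cut_le (cut_after j) c by apply/cut_after_le.
      by case: np; apply/has_predP; exists j.
    + by exists j.
  split=> [[u [tu cu P]]|[v vc Vv]].
    exists w => // e we ec; exists u; split=> //.
      exact: cut_le_trans (cut_ltW ec) cu.
    move=> j ej uj; have [cj|/aboveP cj] := pselect (below c j); last exact: P.
    by apply: Pw => //; move: ej; rewrite !aboveP => nb /(cut_ltW we).
  have [m [wm vm mc]] : exists m, [/\ cut_le w m, cut_le v m & cut_lt m c].
    by have [wv|vw] := cut_le_total w v; [exists v|exists w]; split=> //; exact: cut_lexx.
  have [e [me ec]] : exists e, cut_lt m e /\ cut_lt e c.
    by apply: contrapT => ne; apply: np; exists m.
  (* There is no target between [v] and [c], so [u] is not below [c], and [c] reaches it as well. *)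
  have [[u [tu eu P]] _] := Vv e (cut_le_lt_trans vm me) ec.
  have [cu|/cut_ltNge uc] := pselect (cut_le c u).
    exists u; split=> // j cj uj; apply: P => //.
    by move: cj; rewrite !aboveP => nb /(cut_ltW ec).
  have [|_ /(_ tu)//] := Vv u _ uc.
  by apply: cut_lt_le_trans eu; exact: cut_le_lt_trans me.
Qed.

(** A wrong positive guess could be postponed from cut to cut; only [~ V cmax] stops it. *)
Lemma backward_unique V : backward V -> forall e, V e <-> reaches e.
Proof.
move=> [Vmax Vs Vr Vl] e; split=> [Ve|[u [tu eu P]]].
  apply: contrapT => nr; apply: Vmax.
  (* Besides the guess, [K] keeps [P1] true from [e] up to [c]. A target satisfying [K] would be
     reached by [e], so there is none and the guess must be handed on. *)
  pose K c := V c /\ forall j, above e j -> below c j -> P1 j.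
  have Kt c : cut_le e c -> K c -> ~ target c.
    by move=> ec [_ P] tc; apply: nr; exists c.
  suff [] : K cmax by [].
  apply: (@cut_ind_up _ _ e K) => //.
  - by split=> // j /aboveP.
  - move=> j ej Kj; have [/Vs[/(Kt _ ej Kj)//|[Pj Vj]] Pb] := Kj.
    split=> // k ek; rewrite /= le_eqVlt => /orP[/eqP->//|]; exact: Pb.
  - move=> c ec np IH.
    have Pc j : above e j -> below c j -> P1 j.
      move=> ej cj.
      have [||_] := IH (cut_after j); last by apply=> //=.
        by apply/cut_ltW/lt_cut_after.
      have /cut_le_eqVlt[cE|//] : cut_le (cut_after j) c by apply/cut_after_le.
      by case: np; apply/has_predP; exists j.
    split=> //; have nmin : c <> cmin by move=> cE; move: ec; rewrite cE => /cut_ltNge[].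
    have [|_] := Vl c nmin np.
      exists e => // f ef fc [j fE /negP]; apply; apply: Pc.
        by apply/lt_cut_after; rewrite -fE.
      by apply/cut_after_le; rewrite -fE; exact: cut_ltW.
    (* By [Kt] no cut between [e] and [c] is a target, as the rule at left limits requires. *)
    apply; exists e => // f /cut_ltW ef fc; have Kf := IH f ef fc.
    by split; [case: Kf|exact: Kt].
  - move=> c ec nmax ns Kc; have [/(Vr c nmax ns)[/(Kt _ ec Kc)//|[w cw VP]] Pc] := Kc.
    exists w => // f cf fw; split; first by case: (VP f cf fw).
    move=> j ej fj; have [cj|/aboveP cj] := pselect (below c j); first exact: Pc.
    apply: contrapT => /negP nPj; have [||_ []] := VP (cut_after j); last by exists j.
      exact/lt_cut_after.
    by apply: cut_le_lt_trans fw; apply/cut_after_le.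
(* The guard confines the descent from [u] to the cuts from [e] upwards, where [P] supplies the
   first operand; below [e] the claim is vacuous. *)
suff: cut_le e e -> V e by apply.
apply: (@cut_ind_down _ _ u (fun c => cut_le e c -> V c)) => //.
- move=> _; have [/has_succP[j uE]|ns] := pselect (has_succ u).
    by rewrite uE; apply/Vs; left; rewrite -uE.
  have nmax : u <> cmax by move=> uE; move: tu; rewrite uE; exact: target_cmax.
  by apply/Vr => //; left.
- move=> j /cut_after_le uj IH /le_cut_before ej; apply/Vs; right; split; first exact: P.
  by apply: IH; apply/cut_ltW/lt_cut_after.
- move=> c cu ns IH ec.
  have nmax : c <> cmax by move=> cE; move: cu; rewrite cE => /cut_ltNge[].
  apply/Vr => //; right; exists u => // f cf fu; split.
    by apply: IH; [|exact: cut_ltW|exact: cut_le_trans (cut_ltW cf)].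
  move=> [j fE /negP]; apply; apply: P.
    by apply/lt_cut_after; rewrite -fE; exact: cut_le_lt_trans cf.
  by apply/cut_after_le; rewrite -fE; exact: cut_ltW.
- move=> c cu nmin np IH; have [ce|nce] := pselect (cut_le c e).
    exists cmin => [|f _ fc ef]; first exact: cmin_lt.
    by move/cut_ltNge: fc => []; exact: cut_le_trans ef.
  have ec : cut_lt e c by apply/cut_ltNge.
  have [|/(_ (IH (cut_ltW ec)))[w wc Vw] _] := Vl c nmin np.
    exists e => // f ef fc [j fE /negP]; apply; apply: P.
      by apply/lt_cut_after; rewrite -fE.
    by apply/cut_after_le; rewrite -fE; apply: cut_le_trans cu; exact: cut_ltW.
  by exists w => // f wf fc _; exact: Vw.
Qed.

End Semantics.

(* A state records whether its cut [reaches] a target, is a [target], is a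
   [limit], and is [after_not] the first, respectively the second, operand. *)
Notation marks := (bool * bool * bool * bool * bool)%type.
Implicit Type q : marks.
Let reach_bit q := q.1.1.1.1.
Let target_bit q := q.1.1.1.2.
Let limit_bit q := q.1.1.2.
Let not1_bit q := q.1.2.
Let not2_bit q := q.2.

(** The conditions on the reach bit copy the rules of [backward]. The output is the reach bit of the
    cut after the letter, because both connectives are strict. *)
Definition reach_automaton : automaton (bool * bool)%type bool := {|
  state := marks;
  succ_trans := finset (fun t : marks * (bool * bool) * bool * marks =>
    let: (q, p, b, q') := t in
    [&& ~~ limit_bit q', not1_bit q' == ~~ p.1, not2_bit q' == ~~ p.2,
        target_bit q == is_until && p.2 &
        (reach_bit q == target_bit q || p.1 && reach_bit q') && (b == reach_bit q')]);
  left_lim_trans := finset (fun t : {set marks} * marks =>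
    let: (Q, q) := t in
    [&& limit_bit q, ~~ not1_bit q, ~~ not2_bit q &
        [forall r in Q, ~~ not1_bit r] ==>
        (reach_bit q ==> [forall r in Q, reach_bit r]) &&
        ([forall r in Q, reach_bit r && ~~ target_bit r] ==> reach_bit q)]);
  right_lim_trans := finset (fun t : marks * {set marks} =>
    let: (q, Q) := t in
    (target_bit q == [&& ~~ is_until, limit_bit q, ~~ [forall r in Q, ~~ not1_bit r]
                       & [forall r in Q, ~~ not2_bit r]]) &&
    (reach_bit q == target_bit q || [forall r in Q, reach_bit r && ~~ not1_bit r]));
  init := finset (fun q => [&& ~~ limit_bit q, ~~ not1_bit q & ~~ not2_bit q]);
  final := finset (fun q => ~~ target_bit q && ~~ reach_bit q) |}.

(** * Accepting runs as correctly marked solutions of the local rules *)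

Section Run.
Context {d : Order.disp_t} {J : orderType d}.
Variable x : J -> bool * bool.
Implicit Types (c e w : cut J) (j k : J) (rho : cut J -> marks).

Let P1 j := (x j).1.
Let P2 j := (x j).2.

(** The reach bit is left out: it is a guess, while the other four are forced by the letters and the
    limit sets. *)
Definition marked rho : Prop := forall c,
  [/\ target_bit (rho c) <-> target x c, limit_bit (rho c) <-> limit c,
      not1_bit (rho c) <-> after_not P1 c & not2_bit (rho c) <-> after_not P2 c].

Lemma eqb_iff (b b' : bool) : b == b' <-> (b <-> b').
Proof. by case: b b' => [] []; split=> //; case; auto. Qed.

Lemma lim_left_all rho c (b : pred marks) (B : cut J -> Prop) :
    (forall e, b (rho e) <-> B e) -> c <> cmin ->
  [forall q in lim_left rho c, b q] <->
  exists2 w, cut_lt w c & forall e, cut_lt w e -> cut_lt e c -> B e.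
Proof.
move=> bB nc; have := lim_leftP rho b nc; rewrite (propext (rwP forall_inP)) => ->.
by split=> -[w wc Bw]; exists w => // e we ec; apply/bB; exact: Bw.
Qed.

Lemma lim_right_all rho c (b : pred marks) (B : cut J -> Prop) :
    (forall e, b (rho e) <-> B e) -> c <> cmax ->
  [forall q in lim_right rho c, b q] <->
  exists2 w, cut_lt c w & forall e, cut_lt c e -> cut_lt e w -> B e.
Proof.
move=> bB nc; have := lim_rightP rho b nc; rewrite (propext (rwP forall_inP)) => ->.
by split=> -[w cw Bw]; exists w => // e ce ew; apply/bB; exact: Bw.
Qed.

Section Marks.
Variable rho : cut J -> marks.
Hypothesis limitE : forall c, limit_bit (rho c) <-> limit c.
Hypothesis not1E : forall c, not1_bit (rho c) <-> after_not P1 c.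
Hypothesis not2E : forall c, not2_bit (rho c) <-> after_not P2 c.

Lemma not1EN c : ~~ not1_bit (rho c) <-> ~ after_not P1 c.
Proof. by rewrite -not1E; split=> /negP. Qed.

Lemma not2EN c : ~~ not2_bit (rho c) <-> ~ after_not P2 c.
Proof. by rewrite -not2E; split=> /negP. Qed.

(** Correctness of the target bits is not yet assumed here: [run_marked] derives it from the other
    three marks by this equivalence. *)
Lemma target_bit_right c : c <> cmax -> ~ has_succ c ->
  [&& ~~ is_until, limit_bit (rho c),
      ~~ [forall r in lim_right rho c, ~~ not1_bit r]
    & [forall r in lim_right rho c, ~~ not2_bit r]] <-> target x c.
Proof.
move=> nmax ns; case: (boolP is_until) => [st|/negbTE nst] /=.
  by split=> // /(target_nsucc st ns).
have all1 := @lim_right_all rho c (fun r => ~~ not1_bit r) _ not1EN nmax.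
have all2 := @lim_right_all rho c (fun r => ~~ not2_bit r) _ not2EN nmax.
rewrite targetF //; split=> [/and3P[/limitE lc /negP n1 /all2 n2]|[lc n1 /all2 n2]].
  by split=> // /all1.
by apply/and3P; split=> //; [exact/limitE|apply/negP => /all1].
Qed.

Lemma reach_bit_right c : c <> cmax ->
  [forall r in lim_right rho c, reach_bit r && ~~ not1_bit r] <->
  exists2 w, cut_lt c w & forall e, cut_lt c e -> cut_lt e w ->
    reach_bit (rho e) /\ ~ after_not P1 e.
Proof.
apply: (lim_right_all (b := fun r => reach_bit r && ~~ not1_bit r)) => e.
by rewrite -not1EN; split=> /andP.
Qed.

Hypothesis targetE : forall c, target_bit (rho c) <-> target x c.

Lemma reach_bit_left c : c <> cmin ->
  [forall r in lim_left rho c, reach_bit r && ~~ target_bit r] <->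
  exists2 w, cut_lt w c & forall e, cut_lt w e -> cut_lt e c ->
    reach_bit (rho e) /\ ~ target x e.
Proof.
apply: (lim_left_all (b := fun r => reach_bit r && ~~ target_bit r)) => e.
by rewrite -targetE; split=> [/andP[? /negP]|[? /negP ?]]; [split|apply/andP].
Qed.

End Marks.

(** Seen from the left, every cut is some [cut_after j], [cmin] or a left limit, which settles the
    limit bit and both failure marks. Seen from the right, it is some [cut_before j], [cmax] or a
    right limit, which then settles the target bit. *)
Lemma run_marked rho y :
  accepting_run (A := reach_automaton) x rho y -> marked rho.
Proof.
case=> -[]; rewrite !inE => /and3P[l0 n10 n20] /andP[tM _] rs rl rr.
have left c : [/\ limit_bit (rho c) <-> limit c,
    not1_bit (rho c) <-> after_not P1 c & not2_bit (rho c) <-> after_not P2 c].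
  have [/has_predP[j ->]|np] := pselect (has_pred c).
    have := rs j; rewrite inE => /and5P[/negbTE-> /eqP-> /eqP-> _ _].
    split; [|exact: iff_sym (after_not_after _ _)|exact: iff_sym (after_not_after _ _)].
    by split=> // -[_ []]; apply/has_predP; exists j.
  have [a1 a2] := (after_not_pred (R := P1) np, after_not_pred (R := P2) np).
  have [->|nmin] := pselect (c = cmin).
    rewrite (negbTE l0) (negbTE n10) (negbTE n20).
    by split; split=> // -[] // j /esym/cut_after_neq_cmin.
  have := rl c nmin np; rewrite inE => /and4P[-> /negbTE-> /negbTE-> _].
  by split; split.
have [lE n1E n2E] : [/\ forall c, limit_bit (rho c) <-> limit c,
    forall c, not1_bit (rho c) <-> after_not P1 c
  & forall c, not2_bit (rho c) <-> after_not P2 c].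
  by split=> c; case: (left c).
move=> c; split=> //; have [/has_succP[j ->]|ns] := pselect (has_succ c).
  by have := rs j; rewrite inE target_before => /and5P[_ _ _ /eqP-> _].
have [->|nmax] := pselect (c = cmax).
  by rewrite (negbTE tM); split=> // /target_cmax.
have := rr c nmax ns; rewrite inE => /andP[/eqP-> _].
exact: target_bit_right.
Qed.

(** Once the marks are right, the transitions and final states demand of the reach bit exactly the
    rules of [backward]. *)
Lemma reach_run rho y : accepting_run (A := reach_automaton) x rho y <->
  [/\ marked rho, backward x (fun c => reach_bit (rho c)) &
      y = fun j => reach_bit (rho (cut_after j))].
Proof.
suff rules : marked rho ->
    accepting_run (A := reach_automaton) x rho y <->
    (backward x (fun c => reach_bit (rho c)) /\
     y = fun j => reach_bit (rho (cut_after j))).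
  split=> [run|[mk bw yE]]; last by apply/rules.
  by have mk := run_marked run; have /rules[] := run.
move=> mk.
have [tE lE n1E n2E] : [/\ forall c, target_bit (rho c) <-> target x c,
    forall c, limit_bit (rho c) <-> limit c,
    forall c, not1_bit (rho c) <-> after_not P1 c
  & forall c, not2_bit (rho c) <-> after_not P2 c].
  by split=> c; case: (mk c).
split.
  case=> -[]; rewrite !inE => _ /andP[_ rM] rs rl rr; split; last first.
    apply/funext => j; have := rs j; rewrite inE => /and5P[_ _ _ _].
    by case/andP=> _ /eqP.
  split.
  - exact/negP.
  - move=> j; have := rs j; rewrite inE => /and5P[_ _ _ _] /andP[/eqP-> _].
    rewrite -tE; split=> [/orP[]|[->//|[]]]; first by left.
      by case/andP=> p1 r; right.
    by rewrite /P1 => -> ->; rewrite orbT.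
  - move=> c nmax ns; have := rr c nmax ns; rewrite inE => /andP[_ /eqP->].
    by rewrite -tE -reach_bit_right //; split=> /orP.
  - move=> c nmin np; have := rl c nmin np; rewrite inE => /and4P[_ _ _ /implyP].
    rewrite -(@lim_left_all rho c (fun r => ~~ not1_bit r) _ (not1EN n1E) nmin).
    rewrite -(reach_bit_left tE nmin).
    rewrite -(@lim_left_all rho c reach_bit) //.
    by move=> all1 /all1/andP[/implyP ? /implyP ?]; split.
case=> -[rM rs rr rl] ->; split.
- rewrite !inE; split.
    apply/and3P; split; apply/negP; rewrite ?lE ?n1E ?n2E.
    + by case.
    + by case=> j /esym/cut_after_neq_cmin.
    + by case=> j /esym/cut_after_neq_cmin.
  apply/andP; split; apply/negP => //; rewrite tE; exact: target_cmax.
- move=> j; rewrite inE; apply/and5P; split.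
  + by apply/negP; rewrite lE => -[_ []]; apply/has_predP; exists j.
  + by apply/eqb_iff; rewrite n1E after_not_after.
  + by apply/eqb_iff; rewrite n2E after_not_after.
  + by apply/eqb_iff; rewrite tE target_before.
  + rewrite eqxx andbT; apply/eqb_iff; rewrite rs -tE.
    split=> [[->//|[]]|/orP[]]; last by case/andP=> p1 r; right.
      by rewrite /P1 => -> ->; rewrite orbT.
    by left.
- move=> c nmin np; rewrite inE; apply/and4P; split.
  + exact/lE.
  + by apply/negP; rewrite n1E; exact: after_not_pred.
  + by apply/negP; rewrite n2E; exact: after_not_pred.
  + have all1 := @lim_left_all rho c (fun r => ~~ not1_bit r) _ (not1EN n1E) nmin.
    apply/implyP => /all1/(rl c nmin np).
    rewrite -(reach_bit_left tE nmin) -(@lim_left_all rho c reach_bit) //.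
    by case=> ? ?; apply/andP; split; apply/implyP.
- move=> c nmax ns; rewrite inE; apply/andP; split; apply/eqb_iff.
    by rewrite target_bit_right.
  rewrite rr // -tE -reach_bit_right //; split=> [|/orP//].
  by move=> ?; apply/orP.
Qed.

End Run.

Lemma computable_reach : computable (fun d (J : orderType d) (x : J -> bool * bool) j =>
  `[< (if is_until then until else stavi_until) [set i | (x i).1] [set i | (x i).2] j >]).
Proof.
exists reach_automaton => d J x; split; last first.
  move=> rho y /reach_run[_ bw ->]; apply/funext => j; apply/idP/asboolP.
    by move/(backward_unique bw)/connectiveP.
  by move/connectiveP/(backward_unique bw).
(* The true values at all cuts form an accepting run. *)
pose rho c : marks := (`[<reaches x c>], `[<target x c>], `[<limit c>],
  `[<after_not (fun j => (x j).1) c>], `[<after_not (fun j => (x j).2) c>]).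
exists rho, (fun j => reach_bit (rho (cut_after j))); apply/reach_run; split=> //.
  by move=> c; rewrite /target_bit /limit_bit /not1_bit /not2_bit /= !asboolE.
rewrite [X in backward _ X](_ : _ = reaches x); first exact: backward_reaches.
by apply/funext => c; rewrite /reach_bit /= asboolE.
Qed.

End Reach.

(** * Induction on formulas *)

Lemma computable_truth_word (AP : finType) (phi : ltl AP) :
  computable (fun d (J : orderType d) (x : J -> {set AP}) => truth_word x phi).
Proof.
have ext (S G : finType) (f f' : transduction S G) :
    (forall d (J : orderType d) x, f d J x = f' d J x) -> computable f -> computable f'.
  by move=> ff' [A fA]; exists A => d J x; rewrite -ff'.
elim: phi => [p|phi IH|phi IH psi IH'|phi IH psi IH'|phi IH psi IH'|phi IH psi IH'
  |phi IH psi IH'].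
- apply: ext (computable_map (fun a : {set AP} => p \in a)) => d J x.
  by apply/funext => j; rewrite /truth_word /= asboolb.
- apply: ext (computable_comp IH (computable_map negb)) => d J x.
  by apply/funext => j; rewrite /truth_word /= asbool_neg.
- apply: ext (computable_comp (computable_pair IH IH')
    (computable_map (fun p => p.1 || p.2))) => d J x.
  by apply/funext => j; rewrite /truth_word /= asbool_or.
- apply: ext (computable_comp (computable_pair IH IH') (computable_reach true)) => d J x.
  by apply/funext => j; rewrite /truth_word /=; congr (`[<until _ _ _>]);
    apply/funext => i; rewrite /= asboolE.
(* The operands are evaluated on [J] itself and only the automaton of the outer connective is
   mirrored, in accordance with [since]. *)
- apply: ext (computable_comp (computable_pair IH IH')
    (computable_mirror (computable_reach true))) => d J x.
  by apply/funext => j; rewrite /truth_word /=; congr (`[<since _ _ _>]);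
    apply/funext => i; rewrite /= asboolE.
- apply: ext (computable_comp (computable_pair IH IH') (computable_reach false)) => d J x.
  by apply/funext => j; rewrite /truth_word /=; congr (`[<stavi_until _ _ _>]);
    apply/funext => i; rewrite /= asboolE.
- apply: ext (computable_comp (computable_pair IH IH')
    (computable_mirror (computable_reach false))) => d J x.
  by apply/funext => j; rewrite /truth_word /=; congr (`[<stavi_since _ _ _>]);
    apply/funext => i; rewrite /= asboolE.
Qed.

Theorem theorem1 (AP : finType) (phi : ltl AP) :
  exists A : automaton {set AP} bool,
    forall (d : Order.disp_t) (J : orderType d) (x : J -> {set AP}),
      (exists (rho : cut J -> state A) (y : J -> bool),
          accepting_run x rho y) /\
      (forall (rho : cut J -> state A) (y : J -> bool),
          accepting_run x rho y -> y = truth_word x phi).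
Proof. exact: computable_truth_word. Qed.
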